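(* Let $\kappa$ be an uncountable cardinal. There exists a $\kappa$-cc branchwise-real tree order with no continuous grading if and only if there exists a ${<}\kappa$-wide $\mathbb{R}$-ungradable tree.
   Context: A tree order is a partial order with a minimum element such that for every $x$ the set $\{y\mid y\le x\}$ is linearly ordered; a branch is a maximal linearly ordered subset. A branchwise-real tree order is a tree order in which every branch is order-isomorphic to a real interval and any two elements have a greatest lower bound. A continuous grading is a strictly monotonic $\ell\colon X\to\mathbb{R}$ whose restriction to each $[x,y]=\{z\mid x\le z\le y\}$ ($x<y$) is an order-isomorphism onto $[\ell(x),\ell(y)]$. An antichain is a set of pairwise incomparable elements; a tree order is $\kappa$-cc if it has no antichain of size $\kappa$. A well-stratified tree is a tree order in which each $\{y\mid y\le x\}$ is well-ordered. A tree is $\mathbb{R}$-ungradable if there is no strictly monotonic map from it to $\mathbb{R}$. A ${<}\kappa$-wide $\mathbb{R}$-ungradable tree is an $\mathbb{R}$-ungradable, $\kappa$-cc well-stratified tree with no uncountable branches. *)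

(* Defs.v *)
From HB Require Import structures.
From mathcomp Require Import all_boot all_order all_algebra.
From mathcomp Require Import all_classical all_reals all_analysis.
From mathcomp Require Import wochoice.

Set Implicit Arguments.
Unset Strict Implicit.
Unset Printing Implicit Defensive.

Import Order.TTheory GRing.Theory Num.Theory.
Local Open Scope classical_set_scope.
Local Open Scope order_scope.
Local Open Scope card_scope.

Definition tree_order d (X : porderType d) : Prop :=
  (exists r : X, lbound [set: X] r) /\
  (forall x : X, total_on [set y | y <= x] <=%O).

Definition branch d (X : porderType d) (B : set X) : Prop :=
  total_on B <=%O /\
  (forall C : set X, total_on C <=%O -> B `<=` C -> C = B).

Definition order_iso_on d d' (X : porderType d) (Y : porderType d')
    (A : set X) (B : set Y) (f : X -> Y) : Prop :=
  set_bij A B f /\ {in A &, {mono f : x y / x <= y}}.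

(* [is_interval] is order-convexity: intervals may be open, closed or
   half-open at either end, bounded or not, and degenerate. *)
Definition branchwise_real (R : realType) d (X : porderType d) : Prop :=
  [/\ tree_order X,
      forall B : set X, branch B ->
        exists (I : set R) (f : X -> R), is_interval I /\ order_iso_on B I f
    & forall x y : X, infimums [set x; y] !=set0].

Definition continuous_grading (R : realType) d (X : porderType d)
    (l : X -> R) : Prop :=
  {homo l : x y / x < y} /\
  (forall x y : X, x < y -> order_iso_on `[x, y] `[l x, l y] l).

Definition antichain d (X : porderType d) (A : set X) : Prop :=
  {in A &, forall x y, x != y -> x >< y}.

(* A cardinal is given by a type [K] of that cardinality. *)
Definition cc (K : Type) d (X : porderType d) : Prop :=
  ~ exists A : set X, antichain A /\ A #= [set: K].

Definition well_stratified d (X : porderType d) : Prop :=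
  tree_order X /\ (forall x : X, wo_chain <=%O (<= x)).

Definition ungradable (R : realType) d (X : porderType d) : Prop :=
  ~ exists f : X -> R, {homo f : x y / x < y}.

Definition wide_ungradable (R : realType) (K : Type) d (X : porderType d)
    : Prop :=
  [/\ ungradable R X, cc K X, well_stratified X
    & forall B : set X, branch B -> countable B].

(* Main.v *)
(* For a branchwise-real order X, well-order X and let apex x be the first point
   of the well-order among those above x. The level sets of apex are convex segments of branches, and apexes
   ordered by "the path to n passes through the segment of m" form a
   well-stratified tree; each apex is doubled. A strictly monotonic map on this
   tree allots an interval to each segment, hence gives a strictly monotonic
   L : X -> R that is continuous on segments but may jump between them. The
   outer Lebesgue measure of the image under L of the points below x grades X
   continuously, since it ignores the jumps.
   Conversely, a well-stratified tree T is completed by an edge below each node,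
   limits being joined. Along a branch, the sum of the edge positions with
   dyadic weights is an isomorphism onto a real interval, and a continuous
   grading restricts to a strictly monotonic map on T. *)
Require Import Defs.
From HB Require Import structures.
From mathcomp Require Import all_boot all_order all_algebra.
From mathcomp Require Import all_classical all_reals all_analysis.
From mathcomp Require Import wochoice ring lra.

Set Implicit Arguments.
Unset Strict Implicit.
Unset Printing Implicit Defensive.

Import Order.TTheory GRing.Theory Num.Theory numFieldNormedType.Exports.
Local Open Scope classical_set_scope.
Local Open Scope card_scope.
Local Open Scope ring_scope.
Local Open Scope order_scope.

(** * Outer Lebesgue measure of initial segments *)

Section mass.
Variable R : realType.
Implicit Types (A : set R) (t u : R).
Local Notation lebesgue_outer := ((@lebesgue_measure R)^*)%mu.

Lemma lebesgue_outer_itv_fin t u A : A `<=` `[t, u] ->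
  lebesgue_outer A \is a fin_num.
Proof.
move=> Atu; rewrite ge0_fin_numE ?outer_measure_ge0//.
apply: (@le_lt_trans _ _ (lebesgue_outer `[t, u])); first exact: le_outer_measure.
rewrite measurable_mu_extE//= lebesgue_measure_itv/=.
by case: ifP => _; rewrite ?ltry// -EFinD ltry.
Qed.

(** The outer measure spares any proof that [A] is measurable. *)
Definition mass A t : R := fine (lebesgue_outer (A `&` `]-oo, t])).

(** The half-line up to [t] is Caratheodory measurable, so it splits every set additively. The lower
    bound [a] keeps the outer measures finite, as [fine] requires. *)
Lemma massB A a t u : A `<=` `[a, +oo[ -> t <= u ->
  mass A u = mass A t + fine (lebesgue_outer (A `&` `]t, u])).
Proof.
move=> Aa tu; rewrite /mass -fineD; last 2 first.
- apply: (@lebesgue_outer_itv_fin a t) => x [/Aa]/=.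
  by rewrite !in_itv/= andbT => -> ->.
- apply: (@lebesgue_outer_itv_fin t u) => x [_]/=.
  by rewrite !in_itv/= => /andP[/ltW-> ->].
have mt : (lebesgue_outer).-cara.-measurable [set` `]-oo, t]].
  by apply: sub_caratheodory; apply: sub_sigma_algebra; exact: measurable_itv.
have := mt (A `&` [set` `]-oo, u]]) => ->.
congr (fine (lebesgue_outer _ + lebesgue_outer _)).
  rewrite -setIA; congr (_ `&` _); apply/seteqP; split => x /=.
    by rewrite !in_itv/= => -[].
  by rewrite !in_itv/= => xt; rewrite xt (le_trans xt).
rewrite -setIA; congr (_ `&` _); apply/seteqP; split => x /=.
  by rewrite !in_itv/= => -[-> /negP]; rewrite -ltNge => ->.
by rewrite !in_itv/= => /andP[tx ->]; split => //; apply/negP; rewrite -ltNge.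
Qed.

Lemma le_mass A a t u : A `<=` `[a, +oo[ -> t <= u -> mass A t <= mass A u.
Proof.
by move=> Aa tu; rewrite (massB Aa tu) lerDl fine_ge0// outer_measure_ge0.
Qed.

Lemma mass_lipschitz A a t u : A `<=` `[a, +oo[ -> t <= u ->
  mass A u - mass A t <= u - t.
Proof.
move=> Aa; rewrite le_eqVlt => /predU1P[->|tu]; first by rewrite !subrr.
rewrite (massB Aa (ltW tu)) addrAC subrr add0r.
have <- : fine (lebesgue_outer `]t, u]) = u - t.
  by rewrite measurable_mu_extE//= lebesgue_measure_itv/= lte_fin tu -EFinD.
have sub : `]t, u] `<=` `[t, u] by apply: subset_itvr; rewrite bnd_simp.
apply: fine_le; try exact: le_outer_measure.
- by apply: (@lebesgue_outer_itv_fin t u) => x [_]; exact: sub.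
- exact: lebesgue_outer_itv_fin sub.
Qed.

Lemma lt_mass A a t u : A `<=` `[a, +oo[ -> t < u -> `]t, u] `<=` A ->
  mass A t < mass A u.
Proof.
move=> Aa tu /setIidr tuA; rewrite (massB Aa (ltW tu)) tuA ltrDl.
rewrite measurable_mu_extE//= lebesgue_measure_itv/= lte_fin tu -EFinD/=.
by rewrite subr_gt0.
Qed.

Lemma mass_gap A a t u : A `<=` `[a, +oo[ -> t <= u -> A `&` [set` `]t, u[] = set0 ->
  mass A t = mass A u.
Proof.
move=> Aa tu gap; rewrite (massB Aa tu).
suff -> : lebesgue_outer (A `&` `]t, u]) = 0%E by rewrite addr0.
apply/eqP; rewrite eq_le outer_measure_ge0 andbT.
rewrite -(lebesgue_measure_set1 u) -measurable_mu_extE//.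
apply: le_outer_measure => x [Ax]/=; rewrite in_itv/= => /andP[tx].
rewrite le_eqVlt => /predU1P[//|xu].
by have : set0 x by rewrite -gap; split => //=; rewrite in_itv/= tx.
Qed.

Lemma continuous_mass A a : A `<=` `[a, +oo[ -> continuous (mass A).
Proof.
move=> Aa t; apply/cvgrPdist_lt => e e0; near=> u.
apply: (@le_lt_trans _ _ `|t - u|); last by near: u; exact: cvgr_dist_lt.
have [tu|/ltW ut] := leP t u.
  rewrite ler0_norm ?subr_le0 ?(le_mass Aa)// ler0_norm ?subr_le0// !opprB.
  exact: mass_lipschitz Aa tu.
rewrite ger0_norm ?subr_ge0 ?(le_mass Aa)// ger0_norm ?subr_ge0//.
exact: mass_lipschitz Aa ut.
Unshelve. all: by end_near. Qed.

End mass.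

(** * Branches and continuous gradings *)

Section tree.
Variables (d : Order.disp_t) (X : porderType d).
Implicit Types (x y z : X) (B C : set X).

Lemma chain_sub_branch C : total_on C <=%O -> exists2 B, branch B & C `<=` B.
Proof.
move=> Ctot.
(* Requiring [C] united with [D] to be a chain, rather than [D] to contain [C], makes the union of
   the empty family admissible. *)
have [F FP Ftot|D [DP Dmax]] := @Zorn_bigcup X [set D | total_on (C `|` D) <=%O].
  move=> x y [Cx|[D FD Dx]] [Cy|[E FE Ey]]; first exact: Ctot.
  - by apply: (FP E FE); [left|right].
  - by apply: (FP D FD); [right|left].
  - have [DE|ED] := Ftot _ _ FD FE.
    + by apply: (FP E FE); right => //; exact: DE.
    + by apply: (FP D FD); right => //; exact: ED.
exists (C `|` D); last exact: subsetUl.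
split => // E Etot CDE.
have CE : C `|` E = E by apply/setUidPr => x Cx; apply: CDE; left.
have [ED|nED] := pselect (E `<=` D).
  by apply/seteqP; split => // x /ED; right.
have DE : D `<` E by split => // x Dx; apply: CDE; right.
by have /Dmax := DE; case; rewrite -CE in Etot.
Qed.

Variable R : realType.

(** Real coordinates below [y]: some branch contains this chain, and convexity of the interval of
    that branch gives the second clause. *)
Lemma downset_iso y : branchwise_real R X -> exists f : X -> R,
  (forall a b, a <= y -> b <= y -> (f a <= f b) = (a <= b)) /\
  (forall a t, a <= y -> f a <= t <= f y -> exists2 z, z <= y & f z = t).
Proof.
move=> [[_ down] real_branch _].
have [B Bbranch yB] := chain_sub_branch (down y).
have [I [f [Iitv [[/= fun_f _ f_onto] f_mono]]]] := real_branch _ Bbranch.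
exists f; split=> [a b ay yb|a t ay /andP[at_ ty]].
  by rewrite f_mono// inE; exact: yB.
have [|z Bz fz] := f_onto t.
  by apply: (Iitv (f a) (f y)); rewrite ?at_//; apply: fun_f; apply: yB => /=.
by exists z => //; rewrite -f_mono ?inE// ?fz//; apply: yB => /=.
Qed.

Lemma downset_sup y (S : set X) : branchwise_real R X ->
  S !=set0 -> (forall s, S s -> s <= y) ->
  exists h, [/\ h <= y, ubound S h & forall z, z <= y -> ubound S z -> h <= z].
Proof.
move=> X_real [s0 Ss0] Sy; have [f [f_mono f_onto]] := downset_iso y X_real.
have supS : has_sup (f @` S).
  split; first by exists (f s0), s0.
  by exists (f y) => _ [s Ss <-]; rewrite f_mono ?lexx ?Sy.
have [||h hy fh] := f_onto s0 (sup (f @` S)); first exact: Sy.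
  apply/andP; split; first by apply: ub_le_sup; [case: supS|exists s0].
  by apply: ge_sup; [case: supS|move=> _ [s Ss <-]; rewrite f_mono ?lexx ?Sy].
exists h; split => // [s Ss|z zy Sz].
  by rewrite -(f_mono _ _ (Sy _ Ss) hy) fh; apply: ub_le_sup; [case: supS|exists s].
rewrite -f_mono// fh; apply: ge_sup; first by case: supS.
by move=> _ [s Ss <-]; rewrite f_mono ?(Sy _ Ss)//; exact: Sz.
Qed.

End tree.

(** * From a strictly monotonic map with jumps to a continuous grading *)

Section regrading.
Variables (R : realType) (d : Order.disp_t) (X : porderType d).
Hypothesis X_real : branchwise_real R X.
Variable L : X -> R.
Hypothesis L_homo : {homo L : x y / x < y >-> x < y}.
Hypothesis L_onto : forall x y : X, x < y -> exists w z,
  [/\ x <= w, w < z, z <= y &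
   forall t, L w <= t <= L z -> exists2 v, w <= v <= z & L v = t].

Let down (x y z : X) : x <= z -> y <= z -> (x <= y) || (y <= x).
Proof. by move=> xz yz; case: X_real => -[_ tot] _ _; apply/orP; exact: (tot z). Qed.

Let L_homo_le (x y : X) : x <= y -> L x <= L y.
Proof. by rewrite le_eqVlt => /predU1P[->|/L_homo/ltW]. Qed.

Let L_mono (x y z : X) : x <= z -> y <= z -> (L x <= L y) = (x <= y).
Proof.
move=> xz yz; have /orP[xy|yx] := down xz yz; first by rewrite xy L_homo_le.
apply/idP/idP => [|/L_homo_le//]; case: (eqVneq x y) => [->//|xy].
by rewrite leNgt L_homo// lt_neqAle eq_sym xy.
Qed.

Let image y := L @` [set x | x <= y].

Definition regrading x := mass (image x) (L x).

Let image_bounded : exists a, forall y, image y `<=` `[a, +oo[.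
Proof.
case: X_real => -[[r rmin] _] _ _; exists (L r) => y _ [x _ <-] /=.
by rewrite in_itv/= andbT L_homo_le// rmin.
Qed.

(** Puts the fixed set [image y] in place of [image x], so that all values below [y] come from the
    single continuous function [mass (image y)]. *)
Let regradingE x y : x <= y -> regrading x = mass (image y) (L x).
Proof.
move=> xy; rewrite /regrading /mass; congr (fine (_ _)).
apply/seteqP; split => [_ [[z zx <-] /= Lz]|_ [[z /= zy <-] Lz]]; split=> //.
  by exists z => //=; exact: le_trans xy.
by exists z => //=; move: Lz; rewrite /= in_itv/= (L_mono zy xy).
Qed.

Let regrading_le x y : x <= y -> regrading x <= regrading y.
Proof.
have [a ia] := image_bounded.
by move=> xy; rewrite (regradingE xy) (le_mass (ia _))// L_homo_le.
Qed.

(** The jump-free piece supplied by [L_onto] puts an interval of positive length into the image. *)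
Let regrading_lt x y : x < y -> regrading x < regrading y.
Proof.
have [a ia] := image_bounded.
move=> /L_onto[w [z [xw wz zy wz_onto]]].
apply: le_lt_trans (regrading_le xw) _; apply: lt_le_trans (regrading_le zy).
rewrite (regradingE (ltW wz)); apply: (lt_mass (ia _)); first exact: L_homo.
move=> t /=; rewrite in_itv/= => /andP[/ltW wt tz].
by have [|v /andP[_ vz] <-] := wz_onto t; [rewrite wt|exists v].
Qed.

(* [mass] is continuous, so it attains [c] at some [t]; the supremum [h] of the
   points sent below [t] by [L] differs from [t] only by a gap of the image. *)
Let regrading_onto x y c : x <= y -> regrading x <= c <= regrading y ->
  exists2 z, x <= z <= y & regrading z = c.
Proof.
have [a ia] := image_bounded; move=> xy /andP[xc cy].
have [|||t] := @IVT R (mass (image y)) (L x) (L y) c.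
- exact: L_homo_le.
- exact/continuous_subspaceT/(continuous_mass (ia _)).
- rewrite -(regradingE xy) -(regradingE (lexx y)).
  by apply/andP; split; [rewrite ge_min xc|rewrite le_max cy orbT].
rewrite in_itv/= => /andP[xt ty] tc.
pose S := [set z | (z <= y) /\ L z <= t].
have Sx : S x by [].
have [||h [hy Sh hmin]] := @downset_sup _ X R y S X_real; first by exists x.
  by move=> s [].
exists h; first by rewrite hy andbT; exact: Sh.
rewrite (regradingE hy) -tc; have [ht|/ltW th] := leP (L h) t.
  apply: (mass_gap (ia _)) => //; apply/seteqP; split => // _ [[z /= zy <-]].
  rewrite in_itv/= => /andP[hz zt].
  have /L_homo_le : z <= h by apply: Sh; split => //; exact: ltW.
  by rewrite leNgt hz.
apply/esym/(mass_gap (ia _)) => //; apply/seteqP; split => // _ [[z /= zy <-]].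
rewrite in_itv/= => /andP[tz zh].
suff /L_homo_le : h <= z by rewrite leNgt zh.
apply: hmin => // s [sy st]; rewrite -(L_mono sy zy).
by apply: le_trans st _; exact: ltW.
Qed.

Lemma regrading_continuous : continuous_grading regrading.
Proof.
split; first exact: regrading_lt.
move=> x y xy; have mono (a b : X) : a <= y -> b <= y ->
    (regrading a <= regrading b) = (a <= b).
  move=> ay yb; have /orP[ab|ba] := down ay yb; first by rewrite ab regrading_le.
  apply/idP/idP => [|/regrading_le//]; case: (eqVneq a b) => [->//|ab].
  by rewrite leNgt regrading_lt// lt_neqAle eq_sym ab.
split; last first.
  move=> a b /set_mem/=; rewrite in_itv/= => /andP[_ ay] /set_mem/=.
  by rewrite in_itv/= => /andP[_ yb]; exact: mono.
split.
- move=> a /=; rewrite !in_itv/= => /andP[xa ay].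
  by apply/andP; split; exact: regrading_le.
- move=> a b /set_mem/=; rewrite in_itv/= => /andP[_ ay] /set_mem/=.
  rewrite in_itv/= => /andP[_ yb] /eqP; rewrite eq_le !mono// => /andP[ab ba].
  by apply/le_anti/andP.
- move=> c /=; rewrite in_itv/= => /(regrading_onto (ltW xy))[z xzy <-].
  by exists z => //=; rewrite in_itv.
Qed.

End regrading.

(** * The tree of segments *)

(** A copy of [T] indexed by the proofs of the order axioms, so that the order can be inferred from
    the type. *)
Definition relOrder (T : Type) (r : rel T)
  (_ : reflexive r) (_ : antisymmetric r) (_ : transitive r) := T.

Section relOrder.
Variables (T : Type) (r : rel T).
Hypotheses (r_refl : reflexive r) (r_anti : antisymmetric r).
Hypothesis r_trans : transitive r.
HB.instance Definition _ := gen_eqMixin (relOrder r_refl r_anti r_trans).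
HB.instance Definition _ := gen_choiceMixin (relOrder r_refl r_anti r_trans).
HB.instance Definition _ := @Order.Le_isPOrder.Build (Order.Disp tt tt)
  (relOrder r_refl r_anti r_trans) r r_refl r_anti r_trans.
End relOrder.

(** * Well-orders and well-ordered sets of reals *)

Section well_order.
Variables (T : eqType) (W : rel T).
Hypothesis W_wo : well_order W.

Lemma well_order_least (A : set T) : A !=set0 ->
  exists2 m, A m & forall a, A a -> W m a.
Proof.
move=> [a Aa]; have [|m [[/set_mem Am mA] _]] := W_wo (A := mem A).
  by exists a; exact: mem_set.
by exists m => // b Ab; apply: mA; exact: mem_set.
Qed.

Lemma well_order_total x y : W x y || W y x.
Proof.
have Wpred : wo_chain W predT by move=> A _; exact: W_wo.
exact: (wo_chainW Wpred).
Qed.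

Lemma well_order_anti x y : W x y -> W y x -> x = y.
Proof.
have Wpred : wo_chain W predT by move=> A _; exact: W_wo.
by move=> xy yx; apply: (wo_chain_antisymmetric Wpred); rewrite ?xy.
Qed.

(** Each [m] in [N] is labelled by a rational between [h m] and the value at its successor in [N];
    distinct elements get distinct rationals. *)
Lemma well_ordered_reals_countable (R : realType) (N : set T) (h : T -> R) :
  (forall m n, N m -> N n -> W m n -> m != n -> h m < h n) -> countable N.
Proof.
move=> h_homo.
have gap m : exists q : rat, N m ->
    h m < ratr q /\ forall n, N n -> W m n -> m != n -> ratr q < h n.
  have [Nm|nNm] := pselect (N m); last by exists 0.
  have [later|last] := pselect ([set n | [/\ N n, W m n & m != n]] !=set0).
    have [n0 [Nn0 mn0 mn0'] n0_least] := well_order_least later.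
    have [q] := rat_in_itvoo (h_homo _ _ Nm Nn0 mn0 mn0').
    rewrite in_itv/= => /andP[mq qn0]; exists q => _; split=> // n Nn mn mn'.
    apply: lt_le_trans qn0 _; case: (eqVneq n0 n) => [->//|n0n].
    by apply/ltW/h_homo => //; apply: n0_least.
  (* The last element of [N] has no successor; any rational above its value will do. *)
  have [q] : exists q, ratr q \in `]h m, (h m + 1)[.
    by apply: rat_in_itvoo; rewrite ltrDl.
  rewrite in_itv/= => /andP[mq _]; exists q => _; split=> // n Nn mn mn'.
  by exfalso; apply: last; exists n.
have [q qP] := choice gap.
apply/countable_injP; exists (pickle \o q) => m n /set_mem Nm /set_mem Nn.
move=> /(pcan_inj (@pickleK _)) qmn.
wlog mn : m n Nm Nn qmn / W m n.
  by move=> wlg; have /orP[/wlg->//|/wlg-> //] := well_order_total m n.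
apply/eqP/negPn/negP => mn'; have [_ /(_ n Nn mn mn')] := qP m Nm.
by have [nq _] := qP n Nn; rewrite qmn ltNge (ltW nq).
Qed.
End well_order.

(** * Segments, their apexes and the order on nodes *)

Section segment_tree.
Variables (d : Order.disp_t) (X : porderType d) (W : rel X).
Implicit Types x y z m n : X.

Definition apex x := xget x [set m | x <= m /\ forall a, x <= a -> W m a].

Definition reaches m n := exists2 y, y <= n & apex y = m.

Definition node := {m : X | apex m == m}.

(* Each segment yields two nodes, so that a grading of the nodes reserves a
   nondegenerate interval of reals for every segment, even at limit positions. *)
Definition node_le : rel (node * bool) := fun p q =>
  if val p.1 == val q.1 then p.2 ==> q.2 else `[< reaches (val p.1) (val q.1) >].

Hypotheses (X_tree : tree_order X) (W_wo : well_order W).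

Lemma apexP x : x <= apex x /\ forall a, x <= a -> W (apex x) a.
Proof.
rewrite /apex; case: xgetP => [m _ //|noleast].
have [|m xm m_least] := @well_order_least _ _ W_wo [set a | x <= a].
  by exists x => /=.
by case: (noleast m).
Qed.

Lemma apex_ge x : x <= apex x. Proof. by case: (apexP x). Qed.

Lemma apex_least x a : x <= a -> W (apex x) a.
Proof. by case: (apexP x) => _; exact. Qed.

(** A larger point has fewer points above it, so the first of them can only come later. Convexity of
    segments follows. *)
Lemma apex_homo x y : x <= y -> W (apex x) (apex y).
Proof. by move=> xy; apply: apex_least; exact: le_trans (apex_ge y). Qed.

Lemma apex_id x : apex (apex x) == apex x.
Proof.
apply/eqP/(well_order_anti W_wo).
- exact/apex_least.
- exact/apex_homo/apex_ge.
Qed.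

Lemma apex_convex x y z : x <= y -> y <= z -> apex x = apex z -> apex y = apex z.
Proof.
move=> xy yz xz; apply: (well_order_anti W_wo); first exact: apex_homo.
by rewrite -xz; exact: apex_homo.
Qed.

Lemma reaches_apex x y : x <= y -> reaches (apex x) y.
Proof. by move=> xy; exists x. Qed.

Lemma reaches_wo m n : reaches m n -> W m n.
Proof. by case=> y yn <-; exact: apex_least. Qed.

Let down x y z : x <= z -> y <= z -> (x <= y) || (y <= x).
Proof. by move=> xz yz; apply/orP; case: X_tree => _; apply; [exact: xz|]. Qed.

(** The witnesses [y] and [z] of the two paths both lie below [n]. If [z] comes first, then [n]
    precedes [m] in [W], which forces [m = n]. *)
Lemma reaches_trans m n k : reaches m n -> reaches n k -> reaches m k.
Proof.
move=> mn nk; have /reaches_wo W_mn := mn.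
case: mn nk => y yn ym [z zk zn].
have zn' : z <= n by rewrite -zn apex_ge.
have /orP[yz|zy] := down yn zn'; first by exists y => //; exact: le_trans zk.
suff <- : n = m by exists z.
by apply: (well_order_anti W_wo) => //; rewrite -ym -zn; exact: apex_homo.
Qed.

Lemma reaches_total m n k : reaches m k -> reaches n k ->
  reaches m n \/ reaches n m.
Proof.
move=> [y yk <-] [z zk <-]; have /orP[yz|zy] := down yk zk; [left|right].
- by apply: reaches_apex; exact: le_trans (apex_ge z).
- by apply: reaches_apex; exact: le_trans (apex_ge y).
Qed.

Lemma node_le_refl : reflexive node_le.
Proof. by move=> p; rewrite /node_le eqxx implybb. Qed.

Lemma node_le_anti : antisymmetric node_le.
Proof.
move=> [p b] [q c]; rewrite /node_le /= eq_sym; case: eqP => [/val_inj -> |pq].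
  by case: b c => -[].
case/andP=> /asboolP/reaches_wo Wpq /asboolP/reaches_wo Wqp.
by case: pq; exact: (well_order_anti W_wo).
Qed.

Lemma node_le_trans : transitive node_le.
Proof.
move=> [q c] [p b] [s e]; rewrite /node_le /=.
case: (eqVneq (val p) (val q)) => [-> bc|pq /asboolP Rpq].
  by case: eqVneq => // _; move: b c e bc => [] [] [].
case: (eqVneq (val q) (val s)) => [<- _|qs /asboolP Rqs].
  by rewrite (negPf pq); exact/asboolP.
have Rps := reaches_trans Rpq Rqs; case: eqVneq => [ps|_]; last exact/asboolP.
have Wpq := reaches_wo Rpq; have := reaches_wo Rqs; rewrite -ps => Wqp.
by case/eqP: pq; exact: (well_order_anti W_wo Wpq Wqp).
Qed.

Definition segment_tree := relOrder node_le_refl node_le_anti node_le_trans.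
HB.instance Definition _ := Order.POrder.on segment_tree.

Definition top_point (p : segment_tree) : X := val p.1.

Implicit Types p q : segment_tree.

Lemma segment_leE p q : (p <= q) =
  if top_point p == top_point q then p.2 ==> q.2
  else `[< reaches (top_point p) (top_point q) >].
Proof. by []. Qed.

Lemma apex_top p : apex (top_point p) = top_point p.
Proof. exact/eqP/(valP p.1). Qed.

Lemma segment_le_reaches p q : p <= q -> reaches (top_point p) (top_point q).
Proof.
rewrite segment_leE; case: eqP => [-> _|_ /asboolP//].
by exists (top_point q) => //; exact: apex_top.
Qed.

Lemma top_point_le p q : top_point p != top_point q ->
  top_point p <= top_point q -> p <= q.
Proof.
rewrite segment_leE => /negPf -> pq; apply/asboolP; exists (top_point p) => //.
exact: apex_top.
Qed.

Lemma segment_total p q s : p <= s -> q <= s -> (p <= q) || (q <= p).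
Proof.
move=> /segment_le_reaches ps /segment_le_reaches qs.
rewrite !segment_leE [top_point q == top_point p]eq_sym.
case: (eqVneq (top_point p) (top_point q)) => [_|pq]; first by case: p.2 q.2 => -[].
by apply/orP; have [pq'|qp'] := reaches_total ps qs; [left|right]; exact/asboolP.
Qed.

Lemma segment_tree_well_stratified : well_stratified segment_tree.
Proof.
case: (X_tree) => -[r rmin] _; split.
  split=> [|s p q /= ps qs]; last by apply/orP; exact: segment_total ps qs.
  exists (exist _ (apex r) (apex_id r), false) => q _; rewrite segment_leE.
  by case: eqP => // _; apply/asboolP/reaches_apex; exact: rmin.
move=> s; apply: antisymmetric_wo_chain => [p q _ _|A As [p0 Ap0]].
  exact: le_anti.
have [|m [p Ap pm] m_least] :=
    @well_order_least _ _ W_wo [set top_point p | p in [set` A]].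
  by exists (top_point p0), p0.
(* At most two nodes of [A] lie over the first apex [m]; the lower copy is taken if it is in [A]. *)
have [q [Aq qm q_bit]] : exists q, [/\ q \in A, top_point q = m &
    forall q', q' \in A -> top_point q' = m -> q.2 ==> q'.2].
  have [[q [Aq qm q2]]|none] :=
      pselect (exists q, [/\ q \in A, top_point q = m & q.2 = false]).
    by exists q; split=> // q' _ _; rewrite q2.
  exists p; split=> // q' Aq' q'm; apply/implyP => _; apply/negPn/negP => /negPf q'2.
  by apply: none; exists q'.
exists q; split=> // q' Aq'; case: (eqVneq (top_point q') m) => [q'm|q'm].
  by rewrite segment_leE q'm qm eqxx; exact: q_bit.
have /orP[//|] := segment_total (As _ Aq) (As _ Aq').
rewrite segment_leE qm (negPf q'm) => /asboolP/reaches_wo Wq'm.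
case/eqP: q'm; apply: (well_order_anti W_wo Wq'm).
by apply: m_least; exists q'.
Qed.

(** The two copies of a segment are comparable, so [top_point] is injective on antichains; it keeps
    them antichains by [top_point_le]. *)
Lemma segment_tree_cc (K : Type) : cc K X -> cc K segment_tree.
Proof.
move=> Xcc [A [A_anti AK]]; apply: Xcc; exists (top_point @` A).
have top_inj : {in A &, injective top_point}.
  move=> p q Ap Aq pq; apply/eqP/negPn/negP => /(A_anti _ _ Ap Aq).
  rewrite /Order.comparable !segment_leE pq !eqxx.
  by case: p.2 q.2 => -[].
split; last exact: card_eq_trans (inj_card_eq top_inj) AK.
move=> _ _ /set_mem[p Ap <-] /set_mem[q Aq <-] pq.
have p_q : p != q by apply: contra_neq pq => ->.
have := A_anti p q (mem_set Ap) (mem_set Aq) p_q.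
rewrite /Order.comparable !negb_or => /andP[npq nqp]; apply/andP; split.
  by apply: contra npq; exact: top_point_le.
by apply: contra nqp; apply: top_point_le; rewrite eq_sym.
Qed.

Variable R : realType.
Hypothesis X_real : branchwise_real R X.

(* The points lying below [B] but outside the last segment of [B] form a chain,
   which embeds into the reals and meets every segment of [B] but the last. *)
Lemma segment_branch_countable (B : set segment_tree) : branch B -> countable B.
Proof.
case=> B_chain _.
pose D := [set y | exists p, [/\ B p, y <= top_point p & apex y != top_point p]].
have D_chain : total_on D <=%O.
  move=> y z [p [Bp yp yp']] [q [Bq zq zq']].
  (* The path to [v] meets the segment of [u] at some [x]. If [x <= w], convexity would put [w] in
     that segment, so [w <= x]. *)
  have pull u v w : B u -> B v -> u <= v -> w <= top_point u ->
      apex w != top_point u -> w <= top_point v.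
    move=> Bu Bv; rewrite segment_leE.
    case: eqP => [<- //|_ /asboolP[x xv xu] wu wu'].
    have xu' : x <= top_point u by rewrite -xu apex_ge.
    have /orP[wx|xw] := down wu xu'; first exact: le_trans xv.
    case/eqP: wu'; rewrite -apex_top.
    by apply: (apex_convex xw wu); rewrite xu apex_top.
  have [pq|qp] := B_chain p q Bp Bq.
    by apply/orP; apply: down zq; exact: pull pq yp yp'.
  by apply/orP; apply: down yp _; exact: pull qp zq zq'.
have [E [E_chain Emax] DE] := chain_sub_branch D_chain.
have [_ E_iso _] := X_real.
have [I [f [_ [_ f_mono]]]] := E_iso E (conj E_chain Emax).
have /countable_injP[h h_inj] : countable [set apex y | y in D].
  pose pt m := xget m [set y | D y /\ apex y = m].
  have ptP m : [set apex y | y in D] m -> D (pt m) /\ apex (pt m) = m.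
    by case=> y Dy ym; rewrite /pt; case: xgetP => [? _ //|/(_ y)]; case.
  apply: (@well_ordered_reals_countable _ _ W_wo R _ (f \o pt)) => m n.
  move=> /ptP[Dm pm] /ptP[Dn pn] Wmn mn /=.
  have [/DE Em /DE En] := (Dm, Dn).
  rewrite ltNge f_mono ?inE//; apply: contra mn => nm.
  apply/eqP/(well_order_anti W_wo Wmn).
  by rewrite -pm -pn; exact: apex_homo.
have later p q : B p -> B q -> p <= q -> top_point p != top_point q ->
    [set apex y | y in D] (top_point p).
  move=> Bp Bq; rewrite segment_leE => + /negPf pq; rewrite pq => /asboolP[y yq yp].
  by exists y => //; exists q; rewrite yp pq.
(* Nodes of a last segment of [B] are coded by [None]; the bit separates the two copies. *)
pose not_last p := `[< exists2 q, B q & p <= q /\ top_point p != top_point q >].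
apply/countable_injP.
exists (fun p : segment_tree =>
  pickle (p.2, if not_last p then Some (h (top_point p)) else None)).
move=> p q /set_mem Bp /set_mem Bq /(pcan_inj (@pickleK _)) [bits].
have same : top_point p = top_point q -> p = q.
  case: p q bits {Bp Bq} => [p b] [q c] /= ->.
  by rewrite /top_point /= => /val_inj ->.
rewrite /not_last; case: asboolP => [[p' Bp' [pp' pp'']]|plast];
  case: asboolP => [[q' Bq' [qq' qq'']]|qlast] //.
  case=> /h_inj hpq; apply/same/hpq; apply/mem_set.
    exact: later pp' pp''.
  exact: later qq' qq''.
move=> _; apply: same; apply/eqP/negPn/negP => pq.
have [?|?] := B_chain p q Bp Bq; [apply: plast|apply: qlast].
  by exists q.
by exists p; rewrite // eq_sym.
Qed.

(* [L] maps the segment below [apex x] into the interval between the values of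
   [g] at the two nodes of that segment; [0 / 0 = 0] covers degenerate segments. *)
Lemma segment_tree_ungradable :
  (~ exists l : X -> R, continuous_grading l) -> ungradable R segment_tree.
Proof.
move=> ungraded [g g_homo]; apply: ungraded.
have [[r rmin] _] := X_tree.
have [f f_iso] := choice (fun m => downset_iso m X_real).
have f_mono m a b : a <= m -> b <= m -> (f m a <= f m b) = (a <= b).
  by case: (f_iso m) => mono _; exact: mono.
have f_lt m a b : a < b -> b <= m -> f m a < f m b.
  move=> ab bm; rewrite lt_neqAle f_mono ?(ltW ab)// ?(le_trans (ltW ab))// andbT.
  apply/eqP => fab.
  have : b <= a by rewrite -(f_mono m)// ?fab// (le_trans (ltW ab)).
  by rewrite (lt_geF ab).
pose nd x b : segment_tree := (exist _ (apex x) (apex_id x), b).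
pose low x := g (nd x false); pose high x := g (nd x true).
have low_high x : low x < high x.
  apply: g_homo; rewrite lt_def segment_leE eqxx andbT.
  by apply/eqP => /(congr1 snd).
pose L x := low x + (high x - low x) *
  ((f (apex x) x - f (apex x) r) / (f (apex x) (apex x) - f (apex x) r)).
have fr x : f (apex x) r <= f (apex x) x by rewrite f_mono// ?rmin// apex_ge.
have fx x : f (apex x) x <= f (apex x) (apex x) by rewrite f_mono// apex_ge.
have L_low x : low x <= L x.
  rewrite /L lerDl mulr_ge0// ?divr_ge0 ?subr_ge0//; first exact/ltW.
  exact: le_trans (fx x).
have L_high x : L x <= high x.
  rewrite /L -lerBrDl -[leRHS]mulr1 ler_pM2l ?subr_gt0//.
  have := le_trans (fr x) (fx x); rewrite le_eqVlt => /predU1P[->|lt_r].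
    by rewrite subrr invr0 mulr0.
  by rewrite ler_pdivrMr ?subr_gt0// mul1r lerB.
have nd_same x y b : apex x = apex y -> nd x b = nd y b.
  by move=> xy; congr pair; apply: val_inj.
have width x y : x < y -> apex x = apex y -> f (apex y) r < f (apex y) (apex y).
  move=> xy _; apply: f_lt => //.
  by apply: le_lt_trans (rmin x Logic.I) _; apply: lt_le_trans xy (apex_ge y).
have L_homo : {homo L : x y / x < y}.
  move=> x y xy; have [same|diff] := eqVneq (apex x) (apex y).
    rewrite /L /low /high (nd_same _ _ _ same) (nd_same _ _ _ same) same.
    rewrite ltrD2l ltr_pM2l ?subr_gt0; last exact: low_high.
    rewrite ltr_pM2r ?invr_gt0 ?subr_gt0; last exact: width same.
    by rewrite ltrD2r f_lt ?apex_ge.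
  apply: le_lt_trans (L_high x) _; apply: lt_le_trans (L_low y).
  apply: g_homo; rewrite lt_def segment_leE /= (negPf diff) /top_point /=.
  apply/andP; split; first by apply/eqP => -[/esym/eqP]; rewrite (negPf diff).
  by apply/asboolP/reaches_apex; exact: le_trans (ltW xy) (apex_ge y).
exists (regrading L); apply: regrading_continuous => // x y xy.
(* With the first apex among the points of []x, y]] chosen at [z], monotonicity of [apex] puts all
   of []x, z]] in one segment, where [L] has no jump. *)
have [|_ [z [xz zy] <-] z_least] :=
    @well_order_least _ _ W_wo [set apex z | z in [set z | x < z /\ z <= y]].
  by exists (apex y), y.
have [w [xw wz]] : exists w, x < w /\ w < z.
  have xz' := ltW xz; have zz := lexx z.
  have [|w wz fw] := (f_iso z).2 x ((f z x + f z z) / 2) xz'.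
    by have := f_lt z x z xz zz; lra.
  have lt_f a b : a <= z -> b <= z -> f z a < f z b -> a < b.
    move=> az bz fab; rewrite lt_neqAle -(f_mono z)// (ltW fab) andbT.
    by apply: contraTneq fab => ->; rewrite ltxx.
  by exists w; split; apply: lt_f => //; rewrite fw; have := f_lt z x z xz zz; lra.
have wz_same : apex w = apex z.
  apply: (well_order_anti W_wo); first exact/apex_homo/ltW.
  by apply: z_least; exists w => //; split => //; exact: le_trans (ltW wz) zy.
exists w, z; split=> //; first exact: ltW.
move=> t; pose m := apex z; pose D := f m m - f m r.
have c0 : 0 < high z - low z by rewrite subr_gt0.
have D0 : 0 < D by rewrite subr_gt0; exact: width wz wz_same.
have LE v : apex v = m -> L v = low z + (high z - low z) * ((f m v - f m r) / D).
  by move=> vm; rewrite /L /low /high vm (nd_same _ _ _ vm) (nd_same _ _ _ vm).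
rewrite (LE w)// (LE z)// => /andP[wt tz].
(* The coordinate at which the affine formula for [L] takes the value [t]. *)
pose u := f m r + (t - low z) / (high z - low z) * D.
have tE : t = low z + (high z - low z) * ((u - f m r) / D).
  by rewrite /u; field; rewrite !gt_eqF.
have wm : w <= m by rewrite /m -wz_same apex_ge.
have zm : z <= m by exact: apex_ge.
move: wt tz; rewrite tE !lerD2l !ler_pM2l// !ler_pM2r ?invr_gt0// !lerD2r => wu uz.
have [|v vm fv] := (f_iso m).2 w u wm.
  by rewrite wu (le_trans uz)// f_mono.
move: wu uz; rewrite -fv !f_mono// => wv vz.
by exists v; rewrite ?wv// LE -?fv//; exact: apex_convex wv vz wz_same.
Qed.

End segment_tree.

(** * The road space of a tree *)

Section dyadic_sum.
Variable R : realType.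
Implicit Types u v : nat -> R.

Definition dyadic_sum u : R := limn (series (fun k => 2^-1 ^+ k * u k)).

Lemma is_cvg_dyadic_series u : (forall k, 0 <= u k <= 1) ->
  cvgn (series (fun k => 2^-1 ^+ k * u k)).
Proof.
move=> u01; apply: (@series_le_cvg _ _ (geometric 1 2^-1)) => [k|k|k|].
- by have /andP[u0 _] := u01 k; rewrite mulr_ge0 ?exprn_ge0// invr_ge0.
- by rewrite /= mul1r exprn_ge0 ?invr_ge0.
- have /andP[_ u1] := u01 k; rewrite /= mul1r -[leRHS]mulr1.
  by rewrite ler_wpM2l ?exprn_ge0 ?invr_ge0.
- by apply: is_cvg_geometric_series; rewrite ger0_norm ?invr_ge0 ?invf_lt1 ?ltr1n.
Qed.

Lemma le_dyadic_sum u v : (forall k, 0 <= u k <= 1) -> (forall k, 0 <= v k <= 1) ->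
  (forall k, u k <= v k) -> dyadic_sum u <= dyadic_sum v.
Proof.
move=> u01 v01 uv; apply: lim_series_le; [exact: is_cvg_dyadic_series..|move=> k].
by rewrite ler_wpM2l ?exprn_ge0 ?invr_ge0.
Qed.

Lemma dyadic_partial_le u N : (forall k, 0 <= u k <= 1) ->
  series (fun k => 2^-1 ^+ k * u k) N <= dyadic_sum u.
Proof.
move=> u01; apply: nondecreasing_cvgn_le; last exact: is_cvg_dyadic_series.
apply: nondecreasing_series => k _ _; have /andP[u0 _] := u01 k.
by rewrite mulr_ge0 ?exprn_ge0// invr_ge0.
Qed.

(** Makes the height of a point affine in its position on an edge. *)
Lemma dyadic_sum_conv u v s :
  (forall k, 0 <= u k <= 1) -> (forall k, 0 <= v k <= 1) ->
  dyadic_sum (fun k => u k + s * (v k - u k)) =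
  dyadic_sum u + s * (dyadic_sum v - dyadic_sum u).
Proof.
move=> u01 v01; pose U k : R := 2^-1 ^+ k * u k; pose V k : R := 2^-1 ^+ k * v k.
have cU : cvgn (series U) by exact: is_cvg_dyadic_series.
have cV : cvgn (series V) by exact: is_cvg_dyadic_series.
have cVU : cvgn (series (V - U)) by exact: is_cvg_seriesB.
rewrite /dyadic_sum -[limn (series (fun k => _ * v k))]/(limn (series V)).
rewrite -[limn (series (fun k => _ * u k))]/(limn (series U)).
have sVU : limn (series (s *: (V - U))) = s * limn (series (V - U)).
  exact: lim_seriesZ.
rewrite -lim_seriesB// -sVU.
rewrite -lim_seriesD//; last exact: is_cvg_seriesZ.
congr (limn (series _)); apply/funext => k.
rewrite /U /V !fctE /GRing.scale /=; ring.
Qed.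

Lemma lt_dyadic_sum u v k : (forall k, 0 <= u k <= 1) -> (forall k, 0 <= v k <= 1) ->
  (forall k, u k <= v k) -> u k < v k -> dyadic_sum u < dyadic_sum v.
Proof.
move=> u01 v01 uv uvk; rewrite -subr_gt0.
have duv i : 0 <= v i - u i <= 1.
  by have := uv i; move: (u01 i) (v01 i) => /andP[? ?] /andP[? ?] ?; apply/andP; split; lra.
have <- : dyadic_sum (fun i => v i - u i) = dyadic_sum v - dyadic_sum u.
  rewrite /dyadic_sum; rewrite -lim_seriesB; [|exact: is_cvg_dyadic_series..].
  by congr (limn (series _)); apply/funext => i; rewrite !fctE mulrBr.
apply: lt_le_trans (dyadic_partial_le k.+1 duv).
rewrite /series /= big_nat_recr//= ltr_wpDl//.
  rewrite sumr_ge0// => i _; have /andP[d0 _] := duv i.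
  by rewrite mulr_ge0 ?exprn_ge0// invr_ge0.
by rewrite mulr_gt0 ?exprn_gt0 ?invr_gt0// subr_gt0.
Qed.

End dyadic_sum.

(** * The order on the points of the edges *)

Section road_space.
Variables (R : realType) (d : Order.disp_t) (T : porderType d).
Implicit Types (x y z w : T).

(* A point at position [s] on the edge that ends in [x] is encoded as the
   function equal to [1] below [x], to [s] at [x], and to [0] elsewhere. *)
Definition is_road (f : T -> R) := [/\ forall z, 0 <= f z <= 1,
  forall w z, w < z -> 0 < f z -> f w = 1 & exists x, forall z, 0 < f z -> z <= x].

Definition road_le : rel {f | is_road f} :=
  fun f g => `[< forall z, sval f z <= sval g z >].

Lemma road_le_refl : reflexive road_le.
Proof. by move=> f; apply/asboolP. Qed.

Lemma road_le_anti : antisymmetric road_le.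
Proof.
move=> [f fP] [g gP] /andP[/asboolP/= fg /asboolP/= gf].
by apply/eq_exist/funext => z; apply/le_anti; rewrite fg gf.
Qed.

Lemma road_le_trans : transitive road_le.
Proof.
move=> g f h /asboolP fg /asboolP gh; apply/asboolP => z.
exact: le_trans (fg z) (gh z).
Qed.

Definition road := relOrder road_le_refl road_le_anti road_le_trans.
HB.instance Definition _ := Order.POrder.on road.

Definition road_fun (f : road) : T -> R := sval f.

Lemma road_leP (f g : road) :
  reflect (forall z, road_fun f z <= road_fun g z) (f <= g).
Proof. exact: asboolP. Qed.

Definition road_point x (s : R) : T -> R :=
  fun z => if z < x then 1 else if z == x then s else 0.

Lemma road_point_is_road x s : 0 <= s <= 1 -> is_road (road_point x s).
Proof.
move=> s01; rewrite /road_point; split.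
- by move=> z; case: ifP => _; [rewrite ler01 lexx|case: ifP => _ //; rewrite lexx ler01].
- move=> w z wz; case: ifP => [zx _|_]; first by rewrite (lt_trans wz zx).
  by case: eqP => [<- _|_]; rewrite ?wz// ltxx.
- exists x => z; case: ifP => [/ltW//|_]; case: eqP => [->//|_].
  by rewrite ltxx.
Qed.

Hypothesis T_ws : well_stratified T.

Let down x y z : x <= z -> y <= z -> (x <= y) || (y <= x).
Proof. by move=> xz yz; apply/orP; case: T_ws => -[_ tot] _; exact: (tot z). Qed.

Let least x (A : set T) : A !=set0 -> (forall y, A y -> y <= x) ->
  exists2 m, A m & forall a, A a -> m <= a.
Proof.
move=> [a Aa] Ax; case: T_ws => _ /(_ x) x_wo.
have [||m [[/set_mem Am mA] _]] := x_wo (mem A).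
- by move=> y /set_mem/Ax.
- by exists a; exact: mem_set.
by exists m => // b Ab; apply: mA; exact: mem_set.
Qed.

Lemma road01 (f : road) z : 0 <= road_fun f z <= 1.
Proof. by case: (svalP f). Qed.

Lemma road_ge0 (f : road) z : 0 <= road_fun f z.
Proof. by have /andP[] := road01 f z. Qed.

Lemma road_le1 (f : road) z : road_fun f z <= 1.
Proof. by have /andP[] := road01 f z. Qed.

Lemma road_below (f : road) w z : w < z -> 0 < road_fun f z -> road_fun f w = 1.
Proof. by case: (svalP f) => _ below _; exact: below. Qed.

(** If [f] exceeds [g] at [z0], then [f] is [1] below [z0], while [g] vanishes above [z0], since
    otherwise [g] would be [1] at [z0]. *)
Lemma road_total_bounded (f g : road) x :
  (forall z, 0 < road_fun f z -> z <= x) -> (forall z, 0 < road_fun g z -> z <= x) ->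
  (f <= g) || (g <= f).
Proof.
move=> fx gx; have [//|nfg] := boolP (f <= g).
have [z0 gf] : exists z0, road_fun g z0 < road_fun f z0.
  apply: contrapT => none; move/negP: nfg; apply; apply/road_leP => z.
  by rewrite leNgt; apply/negP => ?; apply: none; exists z.
apply/road_leP => w; have [gw|] := ltP 0 (road_fun g w); last first.
  by move=> gw; apply: le_trans gw _; exact: road_ge0.
have fz0 : 0 < road_fun f z0 by apply: le_lt_trans gf; exact: road_ge0.
have [->|wz0'] := eqVneq w z0; first exact: ltW.
have /orP[wz0|z0w] := down (gx _ gw) (fx _ fz0).
  by rewrite (@road_below f w z0)// ?road_le1// lt_neqAle wz0'.
have z0w' : z0 < w by rewrite lt_neqAle eq_sym wz0'.
by move: gf; rewrite (road_below z0w' gw) ltNge road_le1.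
Qed.

Lemma road_bounded (f : road) : exists x, forall z, 0 < road_fun f z -> z <= x.
Proof. by case: (svalP f). Qed.

Lemma road_total (f g h : road) : f <= h -> g <= h -> (f <= g) || (g <= f).
Proof.
move=> /road_leP fh /road_leP gh; have [x hx] := road_bounded h.
by apply: (@road_total_bounded _ _ x) => z z0; apply: hx; exact: lt_le_trans z0 _.
Qed.

Lemma road_tree_order : tree_order road.
Proof.
split=> [|h f g /= fh gh]; last by apply/orP; exact: road_total fh gh.
have [[[r _] _] _] := T_ws.
have zero : is_road (fun=> 0).
  by split=> [z|w z _|]; [rewrite lexx ler01|rewrite ltxx|exists r => z; rewrite ltxx].
by exists (exist _ _ zero : road) => f _; apply/road_leP => z; exact: road_ge0.
Qed.

Lemma road_infimum (f g : road) : infimums [set f; g] !=set0.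
Proof.
have m_road : is_road (fun z => Num.min (road_fun f z) (road_fun g z)).
  split=> [z|w z wz|].
  - by rewrite le_min !road_ge0 ge_min road_le1.
  - rewrite lt_min => /andP[fz gz].
    by rewrite (road_below wz fz) (road_below wz gz) minxx.
  - have [x fx] := road_bounded f; exists x => z.
    by rewrite lt_min => /andP[/fx].
exists (exist _ _ m_road : road); split.
  by move=> _ [->|->]; apply/road_leP => z; rewrite /= ge_min lexx ?orbT.
move=> h hfg; apply/road_leP => z; rewrite /= le_min.
by apply/andP; split; apply/road_leP; apply: hfg; [left|right].
Qed.

(** Each road gets a node bounding its support. Roads with comparable bounds are comparable, so an
    antichain of roads maps injectively to an antichain of nodes. *)
Lemma road_cc (K : Type) : cc K T -> cc K road.
Proof.
move=> Tcc [A [A_anti AK]]; apply: Tcc.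
have [t tP] := choice road_bounded.
have t_anti (f g : road) : A f -> A g -> t f <= t g -> f = g.
  move=> Af Ag tfg; apply/eqP/negPn/negP => /(A_anti _ _ (mem_set Af) (mem_set Ag)).
  apply/negP; rewrite negbK; apply: (@road_total_bounded _ _ (t g)); last exact: tP.
  by move=> z /tP zf; exact: le_trans tfg.
exists (t @` A); split.
  move=> _ _ /set_mem[f Af <-] /set_mem[g Ag <-] fg; apply/negP => /orP[|] tfg.
    by case/eqP: fg; rewrite (t_anti _ _ Af Ag tfg).
  by case/eqP: fg; rewrite (t_anti _ _ Ag Af tfg).
apply: card_eq_trans AK; apply: inj_card_eq => f g /set_mem Af /set_mem Ag fg.
by apply: t_anti => //; rewrite fg.
Qed.

Lemma road_ungraded : ungradable R T ->
  ~ exists l : road -> R, continuous_grading l.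
Proof.
move=> T_un [l [l_homo _]]; apply: T_un.
have one : 0 <= (1 : R) <= 1 by rewrite ler01 lexx.
exists (fun x => l (exist _ _ (road_point_is_road x one))) => x y xy.
apply: l_homo; rewrite lt_def; apply/andP; split.
  apply/eqP => /(congr1 (fun f => sval f y)); rewrite /= /road_point ltxx eqxx.
  by rewrite (lt_gtF xy) (gt_eqF xy) => /eqP; rewrite oner_eq0.
apply/road_leP => z; rewrite /= /road_point.
case: ifP => [zx|_]; first by rewrite (lt_trans zx xy).
by case: eqP => [->|_]; [rewrite xy|case: ifP => // _; case: ifP].
Qed.

(** * Heights with respect to an enumeration of nodes *)

Section enumerated_chain.
Variable e : nat -> T.

Definition height (f : T -> R) : R := dyadic_sum (f \o e).

Lemma le_height (f g : road) : f <= g -> height (road_fun f) <= height (road_fun g).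
Proof.
by move=> /road_leP fg; apply: le_dyadic_sum => k; [exact: road01..|exact: fg].
Qed.

Lemma height_road_point x s : height (road_point x s) =
  height (road_point x 0) + s * (height (road_point x 1) - height (road_point x 0)).
Proof.
have pt01 b k : 0 <= b <= 1 -> 0 <= (road_point x b \o e) k <= 1.
  by move=> b01; have [pt _ _] := road_point_is_road x b01; exact: pt.
rewrite /height -dyadic_sum_conv.
- congr dyadic_sum; apply/funext => k; rewrite /= /road_point.
  by case: ifP => _; [|case: ifP => _]; ring.
- by move=> k; apply: pt01; rewrite lexx ler01.
- by move=> k; apply: pt01; rewrite lexx ler01.
Qed.

Lemma height_limit x c : 0 <= c ->
  (forall y, y < x -> height (road_point y 1) <= c) -> height (road_point x 0) <= c.
Proof.
move=> c0 yc.
have pt01 b z k : 0 <= b <= 1 -> 0 <= (road_point z b \o e) k <= 1.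
  by move=> b01; have [pt _ _] := road_point_is_road z b01; exact: pt.
have zero01 : 0 <= (0 : R) <= 1 by rewrite lexx ler01.
have one01 : 0 <= (1 : R) <= 1 by rewrite lexx ler01.
apply: limr_le; first by apply: is_cvg_dyadic_series => k; exact: pt01.
apply: nearW => N.
(* A partial sum sees finitely many nodes. If [y] is the largest of those below [x], the full road
   to [y] already has the same terms; if there are none, the sum is [0], whence the hypothesis
   [0 <= c]. *)
have [none|[y yx ymax]] : (forall k, (k < N)%N -> ~~ (e k < x)) \/
    exists2 y, y < x & forall k, (k < N)%N -> e k < x -> e k <= y.
  elim: N => [|N [none|[y yx ymax]]]; first by left.
    have [ex|nex] := boolP (e N < x); [right; exists (e N) => //|left].
      by move=> k; rewrite ltnS leq_eqVlt => /predU1P[->//|/none/negP].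
    by move=> k; rewrite ltnS leq_eqVlt => /predU1P[->//|/none].
  right; have [/andP[ex yex]|nex] := boolP ((e N < x) && (y <= e N)).
    exists (e N) => // k; rewrite ltnS leq_eqVlt => /predU1P[->//|kN kx].
    exact: le_trans (ymax _ kN kx) yex.
  exists y => // k; rewrite ltnS leq_eqVlt => /predU1P[-> ex|]; last exact: ymax.
  move: nex; rewrite ex /= => nex; have := down (ltW ex) (ltW yx).
  by rewrite (negPf nex) orbF.
  rewrite /series /= big_nat big1// => k /andP[_ kN].
  by rewrite /road_point (negPf (none _ kN)) if_same mulr0.
apply: le_trans (yc _ yx).
apply: le_trans (dyadic_partial_le N _) => [|k]; last exact: pt01.
rewrite /series /= big_nat [leRHS]big_nat ler_sum// => k /andP[_ kN].
rewrite ler_wpM2l ?exprn_ge0 ?invr_ge0// /road_point if_same.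
case: ifP => [ex|_]; last by case: ifP => // _; case: ifP.
by have := ymax k kN ex; rewrite le_eqVlt => /orP[->|->]; rewrite ?if_same.
Qed.

(* [x] is the first point at which the height passes [c]; continuity at limits
   places [c] on the edge below [x]. *)
Lemma height_attained (g : road) c : 0 <= c <= height (road_fun g) ->
  exists2 h : road, h <= g & height (road_fun h) = c.
Proof.
move=> /andP[c0]; rewrite le_eqVlt => /predU1P[->|cg]; first by exists g.
have [y gy] := road_bounded g.
have one01 : 0 <= (1 : R) <= 1 by rewrite lexx ler01.
pose A := [set x | x <= y /\ c <= height (road_point x 1)].
have [||x [xy cx] x_least] := @least y A; last first.
- have x0c : height (road_point x 0) <= c.
    apply: height_limit => // z zx; rewrite leNgt; apply/negP => /ltW cz.
    have /x_least : A z by split => //; exact: le_trans (ltW zx) xy.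
    by rewrite (lt_geF zx).
  (* Inverts the affine formula of [height_road_point]. On an edge adding no height, division by
     zero gives [s = 0], and [c] is the height of both ends. *)
  pose s := (c - height (road_point x 0)) /
    (height (road_point x 1) - height (road_point x 0)).
  have x01 := le_trans x0c cx.
  have s01 : 0 <= s <= 1.
    rewrite /s divr_ge0 ?subr_ge0//=.
    move: x01; rewrite le_eqVlt => /predU1P[->|x01].
      by rewrite subrr invr0 mulr0.
    by rewrite ler_pdivrMr ?subr_gt0// mul1r lerB.
  pose h : road := exist _ _ (road_point_is_road x s01).
  have hc : height (road_fun h) = c.
    rewrite /road_fun /= height_road_point /s.
    have [D1|D1] := eqVneq (height (road_point x 1) - height (road_point x 0)) 0.
      rewrite D1 mulr0 addr0; apply/le_anti; rewrite x0c.
      by move/eqP: D1; rewrite subr_eq0 => /eqP <-.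
    by rewrite divfK//; ring.
  exists h => //; have hx z : 0 < road_fun h z -> z <= y.
    rewrite /road_fun /= /road_point.
    case: ifP => [/ltW zx _|_]; first exact: le_trans xy.
    by case: eqP => [->//|_]; rewrite ltxx.
  have /orP[//|/le_height] := road_total_bounded hx gy.
  by rewrite hc leNgt cg.
- by move=> x [].
exists y; split => //; apply: le_trans (ltW cg) _.
apply: (@le_height g (exist _ _ (road_point_is_road y one01))).
apply/road_leP => z; rewrite /road_fun /= /road_point.
have [/gy|] := ltP 0 (road_fun g z); last first.
  by move=> /le_trans; apply; case: ifP => // _; case: ifP.
by rewrite le_eqVlt => /orP[->|->]; rewrite ?if_same road_le1.
Qed.

End enumerated_chain.

Hypothesis T_countable : forall B : set T, branch B -> countable B.

(** The nodes met by a branch form a chain, hence lie in a countable branch of [T] and can be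
    enumerated. Roads of the branch differ only at enumerated nodes, so the height is strictly
    increasing on it. *)
Lemma road_branchwise_real : branchwise_real R road.
Proof.
split; [exact: road_tree_order| |exact: road_infimum] => B [B_chain B_max].
pose C := [set z | exists2 f, B f & 0 < road_fun f z].
have C_chain : total_on C <=%O.
  move=> y z [f Bf fy] [g Bg gz].
  have [h [x hx] [hy hz]] : exists2 h : road,
      exists x, forall z, 0 < road_fun h z -> z <= x &
      0 < road_fun h y /\ 0 < road_fun h z.
    have [/road_leP fg|/road_leP gf] := B_chain f g Bf Bg.
      by exists g; [exact: road_bounded|split=> //; exact: lt_le_trans (fg _)].
    by exists f; [exact: road_bounded|split=> //; exact: lt_le_trans (gf _)].
  by apply/orP; apply: (@down _ _ x); exact: hx.
have [D /T_countable D_count CD] := chain_sub_branch C_chain.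
have /countable_injP[n n_inj] := sub_countable (subset_card_le CD) D_count.
have [[[r _] _] _] := T_ws.
(* Indices that code no node of [C] default to the root [r]; repeated nodes do not disturb
   monotonicity. *)
pose e k := xget r [set z | C z /\ n z = k].
have eK z : C z -> e (n z) = z.
  move=> Cz; rewrite /e; case: xgetP => [w _ [Cw nwz]|/(_ z)]; last by case.
  by apply: n_inj => //; exact/mem_set.
pose F (f : road) := height e (road_fun f).
have F_lt f g : B f -> B g -> f <= g -> f != g -> F f < F g.
  move=> Bf Bg fg f_g; have /road_leP fg' := fg.
  have [z fgz] : exists z, road_fun f z < road_fun g z.
    apply: contrapT => none; case/eqP: f_g; apply/le_anti; rewrite fg.
    apply/road_leP => z; rewrite leNgt; apply/negP => ?; apply: none; by exists z.
  have Cz : C z by exists g => //; apply: le_lt_trans fgz; exact: road_ge0.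
  apply: (@lt_dyadic_sum _ _ _ (n z)) => [k|k|k|]; [exact: road01..|exact: fg'|].
  by rewrite /= eK.
have F_mono f g : B f -> B g -> (F f <= F g) = (f <= g).
  move=> Bf Bg; apply/idP/idP => [|/le_height]; last exact.
  have [fg _|gf] := B_chain f g Bf Bg; first exact: fg.
  have [->//|gf'] := eqVneq g f; by rewrite leNgt F_lt.
exists (F @` B), F; split.
  move=> _ _ [f Bf <-] [g Bg <-] c /andP[fc cg].
  have F0 : 0 <= F f.
    have := @dyadic_partial_le R (road_fun f \o e) 0 (fun k => road01 f (e k)).
    by rewrite /series /= big_geq.
  have [|h hg hc] := @height_attained e g c; first by rewrite (le_trans F0).
  exists h => //.
  (* A road below a member of [B] is comparable with all of [B], so maximality puts [h] in [B] and
     the image is convex. *)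
  have Bh : total_on (h |` B) <=%O.
    have hB k : B k -> h <= k \/ k <= h.
      move=> Bk; have [gk|kg] := B_chain g k Bg Bk.
        by left; exact: le_trans hg gk.
      by apply/orP; exact: road_total hg kg.
    move=> k k' [->|Bk] [->|Bk'].
    - by left.
    - exact: hB.
    - by rewrite or_comm; exact: hB.
    - exact: B_chain.
  by rewrite -(B_max _ Bh) => [|k Bk]; [left|right].
split; last by move=> f g /set_mem Bf /set_mem Bg; exact: F_mono.
split; [by move=> f Bf; exists f| |by []].
move=> f g /set_mem Bf /set_mem Bg fg; apply/le_anti.
by rewrite -!F_mono// fg lexx.
Qed.

End road_space.

Theorem theorem6p14 (R : realType) (K : Type)
    (K_uncountable : ~ countable [set: K]) :
  (exists (d : Order.disp_t) (X : porderType d),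
      [/\ cc K X, branchwise_real R X
        & ~ exists l : X -> R, continuous_grading l])
  <->
  (exists (d : Order.disp_t) (T : porderType d), wide_ungradable R K T).
Proof.
split=> [[d [X [X_cc X_real X_ungraded]]]|[d [T [T_un T_cc T_ws T_countable]]]].
  have [X_tree _ _] := X_real; have [W W_wo] := well_ordering_principle X.
  exists (Order.Disp tt tt), (segment_tree X_tree W_wo); split.
  - exact: segment_tree_ungradable.
  - exact: segment_tree_cc.
  - exact: segment_tree_well_stratified.
  - by move=> B; exact: (segment_branch_countable X_real).
exists (Order.Disp tt tt), (road R T); split.
- exact: road_cc.
- exact: road_branchwise_real.
- exact: road_ungraded.
Qed.
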